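(* In the non-preemptive sUETS problem, the following online algorithm is $O(\sqrt{n/m})$-competitive (i.e., there is an absolute constant $C$ such that its makespan is at most $C\sqrt{n/m}$ times the optimal makespan on every instance): let $k=m+\lceil\sqrt{mn}\rceil$; compute a partition $(X_1,\dots,X_k)$ of $J$ into $k$ (possibly empty) parts such that $|X_i|\le\lceil\sqrt{n/m}\rceil$ for all $i\in[k]$ and which, among all such partitions, minimizes $\max_{i\in[k]}c(X_i)$; then for $i=1,2,\dots,k$ in order, wait until at least one machine is available and assign batch $X_i$ to an available machine.
   Context: Non-preemptive sUETS: a finite set $J$ of $n$ jobs and $m$ identical machines, $n\ge m\ge 2$, all jobs available at time $0$. A known setup-time function $c:2^J\to\mathbb{R}_{\ge0}$ is monotone ($c(X)\le c(Y)$ for $X\subseteq Y$) and subadditive ($c(X)+c(Y)\ge c(X\cup Y)$ for disjoint $X,Y$). Each job $j$ has execution time $p_j\ge0$, unknown to an online algorithm until $j$ completes; $p(X)=\sum_{j\in X}p_j$. An algorithm repeatedly forms batches (sets of jobs not completed and not assigned elsewhere) and assigns each batch to a single idle machine, which processes batch $X$ without interruption in time $c(X)+p(X)$. The makespan is the completion time of all jobs. The optimal makespan is $\min_{(X_1,\dots,X_m)\text{ partition of }J}\max_{i}(c(X_i)+p(X_i))$. An algorithm is $\rho$-competitive if its makespan is at most $\rho$ times the optimal makespan on every instance. *)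

(* Defs.v *)
From HB Require Import structures.
From mathcomp Require Import boolp classical_sets reals.
From mathcomp Require Import all_boot all_order all_algebra.
Set Implicit Arguments.
Unset Strict Implicit.
Unset Printing Implicit Defensive.
Import Order.TTheory GRing.Theory Num.Theory.
Local Open Scope ring_scope.

Section Model.
Variable R : realType.

(* The part of an instance that is known to an online algorithm. *)
Record setting := Setting {
  job : finType;
  nmach : nat;
  setup : {set job} -> R;
  nmach_bounds : (2 <= nmach <= #|job|)%N;
  setup_ge0 : forall X, 0 <= setup X;
  setup_monotone : forall X Y : {set job}, X \subset Y -> setup X <= setup Y;
  setup_subadditive :
    forall X Y : {set job}, [disjoint X & Y] -> setup (X :|: Y) <= setup X + setup Y }.

Record instance := Instance {
  known :> setting;
  exec : job known -> R;
  exec_ge0 : forall j, 0 <= exec j }.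

Definition njobs (P : setting) : nat := #|job P|.

Definition proc_time (I : instance) (X : {set job I}) : R :=
  setup X + \sum_(j in X) exec j.

(* Parts may be empty. *)
Definition ordered_partition (T : finType) k (X : {ffun 'I_k -> {set T}}) : bool :=
  [forall i, forall j, (i != j) ==> [disjoint X i & X j]]
  && (\bigcup_i X i == [set: T]).

(* The infimum is over a finite nonempty set, hence a minimum. *)
Definition optimal_makespan (I : instance) : R :=
  inf [set v : R | exists2 X : {ffun 'I_(nmach I) -> {set job I}},
         ordered_partition X & v = \big[Num.max/0]_i proc_time (X i)]%classic.

Record schedule (I : instance) := Schedule {
  nbatches : nat;
  batch : {ffun 'I_nbatches -> {set job I}};
  machine : 'I_nbatches -> 'I_(nmach I);
  start : 'I_nbatches -> R }.

Definition finish (I : instance) (S : schedule I) (i : 'I_(nbatches S)) : R :=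
  start i + proc_time (batch S i).

Definition feasible (I : instance) (S : schedule I) : Prop :=
  [/\ ordered_partition (batch S),
      forall i : 'I_(nbatches S), 0 <= start i &
      forall i j : 'I_(nbatches S), i != j -> machine i = machine j ->
        finish i <= start j \/ finish j <= start i].

(* The time at which all jobs are completed: a batch without jobs occupies its
   machine, but its own end does not count. *)
Definition makespan (I : instance) (S : schedule I) : R :=
  \big[Num.max/0]_(i | batch S i != set0) finish i.

(* [run I S]: on instance I the algorithm may produce the schedule S; there can
   be several such S because ties are broken arbitrarily. *)
Record algorithm := Algorithm {
  run : forall I : instance, schedule I -> Prop;
  run_total : forall I, exists S, @run I S;
  run_feasible : forall I S, @run I S -> feasible S }.

Definition competitive (A : algorithm) (rho : instance -> R) : Prop :=
  forall (I : instance) (S : schedule I),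
    run A S -> makespan S <= rho I * optimal_makespan I.

(* Batches are assigned in the order of their indices: machine l is available
   at time t for batch i if it has finished all earlier batches it received. *)
Definition available (I : instance) (S : schedule I) (i : 'I_(nbatches S))
    (l : 'I_(nmach I)) (t : R) : Prop :=
  forall i' : 'I_(nbatches S), (i' < i)%N -> machine i' = l -> finish i' <= t.

Definition assignable (I : instance) (S : schedule I) (i : 'I_(nbatches S))
    (t : R) : Prop :=
  [/\ 0 <= t,
      forall i' : 'I_(nbatches S), (i' < i)%N -> start i' <= t &
      exists l, available i l t].

Definition greedy_assignment (I : instance) (S : schedule I) : Prop :=
  forall i : 'I_(nbatches S),
    [/\ assignable i (start i),
        forall t, assignable i t -> start i <= t &
        available i (machine i) (start i)].

(* Only used for x >= 0, where the absolute value changes nothing. *)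
Definition ceiln (x : R) : nat := `|Num.ceil x|%N.

Definition num_parts (P : setting) : nat :=
  (nmach P + ceiln (Num.sqrt (nmach P * njobs P)%:R))%N.

Definition part_size (P : setting) : nat :=
  ceiln (Num.sqrt ((njobs P)%:R / (nmach P)%:R)).

Definition small_partition (P : setting) k (X : {ffun 'I_k -> {set job P}}) : bool :=
  ordered_partition X && [forall i, #|X i| <= part_size P]%N.

Definition max_setup (P : setting) k (X : {ffun 'I_k -> {set job P}}) : R :=
  \big[Num.max/0]_i setup (X i).

(* Depends on the setting only: the execution times are not consulted. *)
Definition min_setup_partition (P : setting) k (X : {ffun 'I_k -> {set job P}}) : Prop :=
  small_partition X /\
  forall Y : {ffun 'I_k -> {set job P}}, small_partition Y -> max_setup X <= max_setup Y.

Definition sqrt_run (I : instance) (S : schedule I) : Prop :=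
  [/\ nbatches S = num_parts I,
      min_setup_partition (batch S) &
      greedy_assignment S].

Lemma le_ceiln (x : R) : 0 <= x -> x <= (ceiln x)%:R.
Proof.
move=> x0; rewrite /ceiln natr_absz ger0_norm ?ceil_ge //.
by rewrite ceil_ge0 (lt_le_trans _ x0) // ltrN10.
Qed.

Lemma njobs_le (P : setting) : (njobs P <= num_parts P * part_size P)%N.
Proof.
have /andP[m2 mn] := nmach_bounds P.
have m0 : (nmach P)%:R != 0 :> R by rewrite pnatr_eq0; case: (nmach P) m2.
rewrite -(ler_nat R) natrM.
have -> : (njobs P)%:R = Num.sqrt (nmach P * njobs P)%:R *
   Num.sqrt ((njobs P)%:R / (nmach P)%:R) :> R.
  rewrite -sqrtrM ?ler0n // natrM -mulrA [_ * (_ / _)]mulrA mulrC divfK //.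
  by rewrite -expr2 sqrtr_sqr ger0_norm.
apply: ler_pM; rewrite ?sqrtr_ge0 // ?le_ceiln ?sqrtr_ge0 //.
by rewrite (le_trans (le_ceiln (sqrtr_ge0 _))) // ler_nat leq_addl.
Qed.

Lemma small_partition_exists (P : setting) :
  exists X : {ffun 'I_(num_parts P) -> {set job P}}, small_partition X.
Proof.
have le_kb := njobs_le P; have /andP[m2 mn] := nmach_bounds P.
have n0 : (0 < njobs P)%N by apply: leq_trans mn; apply: ltnW.
have b0 : (0 < part_size P)%N.
  by case: (part_size P) le_kb => //; rewrite muln0 leqNgt n0.
have f_lt (j : job P) : (enum_rank j %/ part_size P < num_parts P)%N.
  by rewrite ltn_divLR // (leq_trans (ltn_ord _)).
exists [ffun i => [set j | Ordinal (f_lt j) == i]].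
apply/andP; split; first (apply/andP; split).
- apply/forallP => i; apply/forallP => j; apply/implyP => ij.
  rewrite !ffunE -setI_eq0; apply/eqP/setP => x; rewrite !inE.
  by apply/negP => /andP[/eqP -> /eqP eij]; rewrite eij eqxx in ij.
- apply/eqP/setP => j; rewrite inE; apply/bigcupP.
  by exists (Ordinal (f_lt j)); rewrite // ffunE inE.
apply/forallP => i; rewrite ffunE.
set b := part_size P in b0 f_lt *.
pose g (j : job P) : 'I_b := Ordinal (ltn_pmod (enum_rank j) b0).
rewrite -[leqRHS]card_ord -(card_in_imset (f := g)) ?max_card // => x y.
rewrite !inE => /eqP ex /eqP ey [] exy; apply/enum_rank_inj/val_inj => /=.
have /(congr1 val) /= e : Ordinal (f_lt x) = Ordinal (f_lt y) by rewrite ex ey.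
by rewrite (divn_eq (enum_rank x) b) (divn_eq (enum_rank y) b) e exy.
Qed.

Lemma greedy_times_exist m (l0 : 'I_m) (d : nat -> R) n :
  exists (s : nat -> R) (f : nat -> 'I_m),
  let av i l t := forall i', (i' < i)%N -> f i' = l -> s i' + d i' <= t in
  let asg i t := [/\ 0 <= t, forall i', (i' < i)%N -> s i' <= t &
                     exists l, av i l t] in
  forall i, (i < n)%N ->
    [/\ asg i (s i), forall t, asg i t -> s i <= t & av i (f i) (s i)].
Proof.
elim: n => [|n [s [f IHn]]]; first by exists (fun=> 0), (fun=> l0).
pose free l := \big[Num.max/0]_(i < n | f i == l) (s i + d i).
pose lmin := [arg min_(l < l0) free l]%O.
pose t0 := Num.max (free lmin) (\big[Num.max/0]_(i < n) s i).
exists (fun i => if i == n then t0 else s i).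
exists (fun i => if i == n then lmin else f i).
move=> av asg.
have avE i l t : (i <= n)%N -> av i l t <->
    (forall i', (i' < i)%N -> f i' = l -> s i' + d i' <= t).
  move=> lein; split => H i' lti'; have := H i' lti';
    by rewrite (ltn_eqF (leq_trans lti' lein)).
have asgE i t : (i <= n)%N -> asg i t <->
   [/\ 0 <= t, forall i', (i' < i)%N -> s i' <= t & exists l,
    (forall i', (i' < i)%N -> f i' = l -> s i' + d i' <= t)].
  move=> lein; split => -[t_ge0 H [l Hl]]; split => //.
  - by move=> i' lti'; have := H i' lti'; rewrite (ltn_eqF (leq_trans lti' lein)).
  - by exists l; apply/(avE _ _ _ lein).
  - by move=> i' lti'; rewrite (ltn_eqF (leq_trans lti' lein)); apply: H.
  - by exists l; apply/(avE _ _ _ lein).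
move=> i; rewrite ltnS leq_eqVlt => /predU1P[->|lti]; last first.
  have [a b c] := IHn i lti; rewrite (ltn_eqF lti); split.
  - exact/(asgE _ _ (ltnW lti)).
  - by move=> t /(asgE _ _ (ltnW lti)); apply: b.
  - exact/(avE _ _ _ (ltnW lti)).
rewrite eqxx.
have av0 i' : (i' < n)%N -> f i' = lmin -> s i' + d i' <= t0.
  move=> lti' fi'; rewrite le_max; apply/orP; left.
  by apply: (le_bigmax_cond _ (fun i : 'I_n => s i + d i) (j := Ordinal lti')) => /=; apply/eqP.
split.
- apply/(asgE _ _ (leqnn n)); split; last by exists lmin.
    by rewrite le_max [0 <= free _]bigmax_ge_id.
  move=> i' lti'; rewrite le_max; apply/orP; right.
  exact: (le_bigmax _ (fun i : 'I_n => s i) (Ordinal lti')).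
- move=> t /(asgE _ _ (leqnn n))[t_ge0 st [l Hl]].
  rewrite ge_max; apply/andP; split; last by apply: bigmax_le => // j _; apply: st.
  apply: (@le_trans _ _ (free l)).
    by rewrite /lmin; case: arg_minP => // l' _; apply.
  by apply: bigmax_le => // j /eqP fj; apply: Hl.
- exact/(avE _ _ _ (leqnn n)).
Qed.

Lemma sqrt_run_total (I : instance) : exists S : schedule I, sqrt_run S.
Proof.
have [X0 X0P] := small_partition_exists I.
pose X := [arg min_(X < X0 | small_partition X) max_setup X]%O.
have /andP[m2 _] := nmach_bounds I.
pose l0 : 'I_(nmach I) := Ordinal (ltnW m2).
pose d (i : nat) := if insub i is Some o then proc_time (X o) else 0.
have [s [f sfP]] := greedy_times_exist l0 d (num_parts I).
have dE (i : 'I_(num_parts I)) : d i = proc_time (X i) by rewrite /d valK.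
pose S : schedule I := Schedule X (fun i => f (val i)) (fun i => s (val i)).
have avE i l t : @available I S i l t <->
    (forall i', (i' < i)%N -> f i' = l -> s i' + d i' <= t).
  split=> H i' lti' fi'; last by rewrite /finish /= -dE; apply: H.
  have lt := ltn_trans lti' (ltn_ord i).
  by have := H (Ordinal lt) lti' fi'; rewrite /finish /= -dE.
exists S; split=> //.
  rewrite /= /X; case: arg_minP => // Y YP Ymin; split.
move=> i; have [[s0 ss [l sl]] b c] := sfP i (ltn_ord i).
split; last exact/avE.
  split => //; first by move=> i' lti'; apply: ss.
  by exists l; apply/avE.
move=> t [t0 st [l' /avE Hl']]; apply: b; split => //; last by exists l'.
move=> i' lti'; have lt := ltn_trans lti' (ltn_ord i).
exact: (st (Ordinal lt)).
Qed.

Lemma sqrt_run_feasible (I : instance) (S : schedule I) : sqrt_run S -> feasible S.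
Proof.
move=> [_ [/andP[XP _] _] SP]; split => //.
  by move=> i; have [[]] := SP i.
move=> i j ij mij; case: (ltngtP i j) => [lt|lt|/val_inj e].
- by left; have [_ _] := SP j; apply.
- by right; have [_ _] := SP i; apply.
- by rewrite e eqxx in ij.
Qed.

Definition sqrt_batching : algorithm := Algorithm sqrt_run_total sqrt_run_feasible.

End Model.

(* Main.v *)
Require Import Defs.
From mathcomp Require Import all_boot all_order all_algebra.
From mathcomp Require Import reals.
From mathcomp Require Import lra.
Set Implicit Arguments.
Unset Strict Implicit.
Unset Printing Implicit Defensive.
Import Order.TTheory GRing.Theory Num.Theory.
Local Open Scope ring_scope.

(** Let q = sqrt (n / m) and let V be the makespan of an arbitrary partition
    (O_1, ..., O_m).  Cutting each O_i into pieces of size at most ceil q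
    yields at most m + ceil (sqrt (m n)) pieces, each of setup time at most V,
    so every batch of the algorithm has setup time at most V.  A greedy
    schedule starts a batch no later than the average load of the earlier
    batches, which is at most (k V + p(J)) / m = O(q) V, and a single batch has
    at most ceil q jobs, hence takes at most (1 + ceil q) V. *)

Lemma ceiln_le (R : realType) (x : R) : 0 <= x -> (ceiln x)%:R <= x + 1.
Proof.
move=> x0; rewrite /ceiln natr_absz ger0_norm; last first.
  by rewrite ceil_ge0 (lt_le_trans _ x0) // ltrN10.
by have := ceilB1_lt x; rewrite intrB ltrBlDr => /ltW.
Qed.

Lemma ordered_partition_sum (V : nmodType) (T : finType) k
    (X : {ffun 'I_k -> {set T}}) (f : T -> V) :
  ordered_partition X -> \sum_i \sum_(j in X i) f j = \sum_j f j.
Proof.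
move=> /andP[/forallP dX /eqP cX].
rewrite -[LHS]partition_disjoint_bigcup.
  by rewrite cX; apply: eq_bigl => j; rewrite inE.
by move=> i j ij; have /forallP/(_ j)/implyP := dX i; apply.
Qed.

Lemma ordered_partition_exists k (T : finType) : (0 < k)%N ->
  exists X : {ffun 'I_k -> {set T}}, ordered_partition X.
Proof.
case: k => // k _; exists [ffun i => if i == ord0 then [set: T] else set0].
apply/andP; split.
  apply/forallP => i; apply/forallP => j; apply/implyP; rewrite !ffunE -setI_eq0.
  case: (eqVneq i ord0) => [->|_]; last by rewrite set0I.
  by rewrite eq_sym => /negPf ->; rewrite setI0.
apply/eqP/setP => x; rewrite inE; apply/bigcupP.
by exists ord0; rewrite // ffunE eqxx inE.
Qed.

(** A part of size [s] gets [s %/ b + 1] pieces. The quotients sum to at most [#|T| %/ b], and the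
    extra pieces number one per part. *)
Lemma refine_partition (T : finType) m (O : {ffun 'I_m -> {set T}}) b k :
    ordered_partition O -> (0 < m)%N -> (0 < b)%N ->
    (m + #|T| %/ b <= k)%N ->
  exists2 Y : {ffun 'I_k -> {set T}}, ordered_partition Y &
    forall x, (#|Y x| <= b)%N /\ exists i, Y x \subset O i.
Proof.
move=> OP m0 b0 le_k; have /andP[_ /eqP cO] := OP.
have /fin_all_exists[h hO] (j : T) : exists i, j \in O i.
  by have : j \in \bigcup_i O i by [rewrite cO inE]; case/bigcupP => i _; exists i.
(* A piece is named by its part and a number; the number for [j] is the position of [j] in the
   enumeration of its part, divided by [b]. *)
pose K := {i : 'I_m & 'I_(#|O i| %/ b).+1}.
have leK : (#|{: K}| <= k)%N.
  rewrite card_tagged sumnE big_map big_enum /=.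
  under eq_bigr => i _ do rewrite card_ord -addn1.
  rewrite big_split /= sum_nat_const card_ord muln1 addnC.
  apply: leq_trans le_k; rewrite leq_add2l leq_divRL // big_distrl /=.
  rewrite -sum1_card -(ordered_partition_sum _ OP) leq_sum // => i _.
  by rewrite sum1_card leq_divM.
have ltr j : (index j (enum (O (h j))) %/ b < (#|O (h j)| %/ b).+1)%N.
  by rewrite ltnS leq_div2r // cardE index_size.
pose key j : K := Tagged (fun i : 'I_m => 'I_(#|O i| %/ b).+1) (Ordinal (ltr j)).
pose c j := widen_ord leK (enum_rank (key j)).
have cE j j' : c j = c j' -> h j = h j' /\
    (index j (enum (O (h j))) %/ b = index j' (enum (O (h j'))) %/ b)%N.
  move=> /(congr1 val) e; have {}e : key j = key j'.
    exact/enum_rank_inj/val_inj.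
  split; first exact: (congr1 (fun u : K => tag u) e).
  exact: (congr1 (fun u : K => val (tagged u)) e).
exists [ffun x => [set j | c j == x]].
  apply/andP; split.
    apply/forallP => x; apply/forallP => y; apply/implyP => xy.
    rewrite !ffunE -setI_eq0; apply/eqP/setP => j; rewrite !inE.
    by apply: contraNF xy => /andP[/eqP <- /eqP <-].
  by apply/eqP/setP => j; rewrite inE; apply/bigcupP; exists (c j); rewrite ?ffunE ?inE.
move=> x; rewrite ffunE; split.
  (* Within a piece the quotient of the position is fixed, so the residue modulo [b] determines the
     element. *)
  pose r j : 'I_b := Ordinal (ltn_pmod (index j (enum (O (h j)))) b0).
  rewrite -[leqRHS]card_ord -(card_in_imset (f := r)) ?max_card // => y z.
  rewrite !inE => /eqP cy /eqP cz [] /= eyz.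
  have [ehyz edyz] : _ := cE y z (etrans cy (esym cz)).
  have : index y (enum (O (h y))) = index z (enum (O (h z))).
    by rewrite (divn_eq (index y _) b) (divn_eq (index z _) b) eyz edyz.
  have yO : y \in enum (O (h y)) by rewrite mem_enum.
  have zO : z \in enum (O (h y)) by rewrite mem_enum ehyz.
  by rewrite -ehyz => e; rewrite -(nth_index y yO) e nth_index.
have [j0 /eqP cj0|none] := pickP (fun j => c j == x).
  exists (h j0); apply/subsetP => j; rewrite inE => /eqP cj.
  by have [<- _] := cE j j0 (etrans cj (esym cj0)).
(* An index that receives no element gives an empty piece, which lies in any part. *)
by exists (Ordinal m0); apply/subsetP => j; rewrite inE none.
Qed.

Lemma nmach_gt0 (R : realType) (P : setting R) : (0 < nmach P)%N.
Proof. by have /andP[/ltnW] := nmach_bounds P. Qed.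

Lemma proc_time_ge0 (R : realType) (I : instance R) (X : {set job I}) : 0 <= proc_time X.
Proof. by rewrite addr_ge0 ?setup_ge0 ?sumr_ge0 // => j _; apply: exec_ge0. Qed.

Section Greedy.
Variables (R : realType) (I : instance R) (S : schedule I).
(** Only work is counted, not idle time. The index is a plain natural number, so that [i'.+1] can be
    used without a bound proof. *)
Definition load (i : nat) (l : 'I_(nmach I)) : R :=
  \sum_(i' < nbatches S | (i' < i)%N && (machine i' == l)) proc_time (batch S i').

Lemma load_mono i j l : (i <= j)%N -> load i l <= load j l.
Proof.
move=> ij; rewrite /load [leRHS](bigID (fun i' : 'I__ => i' < i)%N) /=.
rewrite ler_wpDr ?sumr_ge0 // => [i' _|]; first exact: proc_time_ge0.
rewrite le_eqVlt; apply/orP; left; apply/eqP/eq_bigl => i'.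
by case: (ltnP i' i) => [lt|]; rewrite ?andbF // (leq_trans lt ij) andbT.
Qed.

Hypothesis SG : greedy_assignment S.

(* Every machine l is free at time [load i l]: by induction, each earlier batch
   on l starts no later than the load of l at that point. *)
Lemma greedy_start_le_load (i : 'I_(nbatches S)) l : start i <= load i l.
Proof.
have [n] := ubnP i; elim: n i l => // n IHn i l /ltnSE lin.
have [_ min_i _] := SG i; apply: min_i; split.
- by rewrite sumr_ge0 // => *; apply: proc_time_ge0.
- move=> i' lt; apply: le_trans (load_mono l (ltnW lt)).
  exact/IHn/(leq_trans lt).
exists l => i' lt ml; apply: (@le_trans _ _ (load i'.+1 l)); last exact: load_mono.
rewrite /finish /load (bigD1 i') /= ?ltnSn ?ml ?eqxx // [leRHS]addrC lerD2r.
apply: le_trans (IHn i' l (leq_trans lt lin)) _.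
rewrite /load le_eqVlt; apply/orP; left; apply/eqP/eq_bigl => j.
by rewrite ltnS ltn_neqAle -andbA [LHS]andbC.
Qed.

(** Sum the bound by [load i l] over all machines [l]: each earlier batch sits on exactly one
    machine, so it is counted once. *)
Lemma greedy_start_le_average (i : 'I_(nbatches S)) :
  (nmach I)%:R * start i <= \sum_i' proc_time (batch S i').
Proof.
rewrite mulr_natl -[X in _ *+ X]card_ord -sumr_const.
apply: le_trans (ler_sum _ (fun l _ => greedy_start_le_load i l)) _.
rewrite /load (exchange_big_dep (fun i' : 'I__ => i' < i)%N) /=; last first.
  by move=> l i' _ /andP[].
rewrite [leRHS](bigID (fun i' : 'I__ => i' < i)%N) /=.
rewrite ler_wpDr ?sumr_ge0 // => [i' _|]; first exact: proc_time_ge0.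
rewrite ler_sum // => i' lt; under eq_bigl => l do rewrite lt eq_sym.
by rewrite big_pred1_eq.
Qed.

End Greedy.

Section Ratio.
Variables (R : realType) (I : instance R).
Let m := nmach I.
Let n := njobs I.
Let q : R := Num.sqrt (n%:R / m%:R).

(** Lets the additive constants caused by rounding be absorbed into a multiple of [q]. *)
Lemma ratio_ge1 : 1 <= q.
Proof.
have /andP[_ le_mn] := nmach_bounds I.
rewrite -[leLHS]sqrtr1 ler_wsqrtr // ler_pdivlMr ?ltr0n ?nmach_gt0 //.
by rewrite mul1r ler_nat.
Qed.

Lemma sqrt_mul_ratio : Num.sqrt (m * n)%:R = m%:R * q.
Proof.
have m0 : m%:R != 0 :> R by rewrite pnatr_eq0 -lt0n nmach_gt0.
rewrite -[in RHS](ger0_norm (ler0n R m)) -sqrtr_sqr -sqrtrM ?sqr_ge0 //.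
by congr Num.sqrt; rewrite natrM expr2 -mulrA [_ * (_ / _)]mulrC divfK.
Qed.

Lemma part_size_gt0 : (0 < part_size I)%N.
Proof.
rewrite -(ltr_nat R) (lt_le_trans ltr01) // (le_trans ratio_ge1) //.
exact/le_ceiln/sqrtr_ge0.
Qed.

(** The piece count needed for [refine_partition]: rounding up both factors of n = sqrt (m n) * q
    bounds n by the product of the two ceilings. *)
Lemma nmach_add_njobs_div : (m + n %/ part_size I <= num_parts I)%N.
Proof.
rewrite leq_add2l -(leq_pmul2r part_size_gt0).
apply: leq_trans (leq_divM _ _) _; rewrite -(ler_nat R) natrM.
have -> : n%:R = Num.sqrt (m * n)%:R * q.
  rewrite sqrt_mul_ratio -mulrA -expr2 sqr_sqrtr ?divr_ge0 //.
  by rewrite mulrC divfK // pnatr_eq0 -lt0n nmach_gt0.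
by apply: ler_pM; rewrite ?sqrtr_ge0 // le_ceiln ?sqrtr_ge0.
Qed.

(** The refinement of [O] competes in the minimization, and monotonicity of [setup] passes the bound
    from parts to pieces. *)
Lemma min_setup_partition_le (X : {ffun 'I_(num_parts I) -> {set job I}})
    (O : {ffun 'I_m -> {set job I}}) (V : R) i :
    min_setup_partition X -> ordered_partition O ->
    (forall l, setup (O l) <= V) ->
  setup (X i) <= V.
Proof.
move=> [_ minX] OP OV.
have [Y YP YO] := refine_partition OP (nmach_gt0 I) part_size_gt0
  nmach_add_njobs_div.
have YS : small_partition Y by rewrite /small_partition YP; apply/forallP => x; case: (YO x).
apply: le_trans (le_trans (minX Y YS) _).
  exact: (le_bigmax _ (fun i => setup (X i))).
apply: bigmax_le => [|x _].
  exact: le_trans (setup_ge0 _) (OV (Ordinal (nmach_gt0 I))).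
by have [_ [l /setup_monotone le]] := YO x; apply: le_trans le (OV l).
Qed.

Lemma sqrt_run_makespan_le (S : schedule I) (O : {ffun 'I_m -> {set job I}}) (V : R) :
    sqrt_run S -> ordered_partition O -> (forall l, proc_time (O l) <= V) ->
  makespan S <= 7 * q * V.
Proof.
move=> [kS XP SG] OP OV.
have V0 : 0 <= V := le_trans (proc_time_ge0 _) (OV (Ordinal (nmach_gt0 I))).
have OcV l : setup (O l) <= V.
  by apply: le_trans (OV l); rewrite lerDl sumr_ge0 // => j _; apply: exec_ge0.
have SV i : setup (batch S i) <= V.
  (* The type of [batch S] depends on [nbatches S], so it is generalized before rewriting with
     [kS]. *)
  move: (batch S) XP i; rewrite kS => X XP i.
  exact: min_setup_partition_le XP OP OcV.
have [/andP[SP /forallP Ssize] _] := XP.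
have q1 := ratio_ge1; have q0 : 0 <= q by apply: sqrtr_ge0.
have mR0 : 0 < m%:R :> R by rewrite ltr0n nmach_gt0.
have pJ : \sum_(j : job I) exec j <= m%:R * V.
  rewrite -(ordered_partition_sum _ OP) mulr_natl.
  rewrite -[X in _ *+ X]card_ord -sumr_const ler_sum // => l _.
  by apply: le_trans (OV l); rewrite lerDr setup_ge0.
(* With k <= m + m q + 1, the factor k + m is at most m (q + 2) + 1, and 1 <= m absorbs the last
   unit. *)
have total : \sum_i proc_time (batch S i) <= m%:R * ((q + 3) * V).
  rewrite big_split /= (ordered_partition_sum _ SP).
  apply: le_trans (lerD (ler_sum _ (fun i _ => SV i)) pJ) _.
  rewrite sumr_const card_ord kS -[V *+ _]mulr_natl -mulrDl mulrA ler_wpM2r //.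
  rewrite natrD -addrA (le_trans (lerD (lexx _) (lerD (ceiln_le (sqrtr_ge0 _)) (lexx _)))) //.
  rewrite sqrt_mul_ratio; have : 1 <= m%:R :> R by rewrite ler1n nmach_gt0.
  by rewrite mulrDr; lra.
have execV (j : job I) : exec j <= V.
  have /andP[_ /eqP cO] := OP.
  have : j \in \bigcup_l O l by rewrite cO inE.
  case/bigcupP => l _ jl; apply: le_trans (OV l).
  rewrite ler_wpDl ?setup_ge0 // (bigD1 j) //= lerDl sumr_ge0 // => *.
  exact: exec_ge0.
have procV i : proc_time (batch S i) <= (q + 2) * V.
  have -> : (q + 2) * V = V + (q + 1) * V by lra.
  rewrite lerD //; apply: le_trans (ler_sum _ (fun j _ => execV j)) _.
  rewrite sumr_const -mulr_natl ler_wpM2r //.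
  by apply: le_trans (ceiln_le q0); rewrite ler_nat.
apply: bigmax_le => [|i _]; first by rewrite !mulr_ge0.
have startV : start i <= (q + 3) * V.
  by rewrite -(ler_pM2l mR0) (le_trans (greedy_start_le_average SG i)).
apply: le_trans (lerD startV (procV i)) _.
(* The sum (q + 3) + (q + 2) is at most 7 q because 1 <= q; this is the source of the constant. *)
by rewrite -mulrDl ler_wpM2r //; lra.
Qed.

End Ratio.

Theorem theorem4 (R : realType) :
  exists C : R,
    competitive (sqrt_batching R)
      (fun I : instance R => C * Num.sqrt ((njobs I)%:R / (nmach I)%:R)).
Proof.
(* Dividing by 7 q > 0 leaves a lower bound on an infimum, to be checked against every partition
   once one is known to exist. *)
exists 7 => I S run_S; rewrite mulrC -ler_pdivrMr; last first.
  by rewrite mulr_gt0 // (lt_le_trans ltr01) // ratio_ge1.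
apply: lb_le_inf.
  have [X XP] := ordered_partition_exists (job I) (nmach_gt0 I).
  by exists (\big[Num.max/0]_i proc_time (X i)), X.
move=> _ [O OP ->]; rewrite ler_pdivrMr; last first.
  by rewrite mulr_gt0 // (lt_le_trans ltr01) // ratio_ge1.
rewrite mulrC; apply: sqrt_run_makespan_le run_S OP _ => l.
exact: (le_bigmax _ (fun l => proc_time (O l))).
Qed.
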